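(* Consider the LSTM network \[ \begin{aligned} x^+ &= \sigma_g(W_f u + U_f \xi + b_f)\circ x + \sigma_g(W_i u + U_i \xi + b_i)\circ \sigma_c(W_c u + U_c \xi + b_c),\\ \xi^+ &= \sigma_g(W_o u + U_o \xi + b_o)\circ \sigma_c(x^+),\qquad y = C\xi + b_y, \end{aligned} \] with state $\chi=(x,\xi)$ and inputs in $\mathcal{U}=[-u_{\max},u_{\max}]^{n_u}$. Let \[ \alpha=\tfrac14\|U_f\|\frac{\bar{\sigma}_g^i\bar{\sigma}_c^c}{1-\bar{\sigma}_g^f}+\bar{\sigma}_g^i\|U_c\|+\tfrac14\|U_i\|\bar{\sigma}_c^c,\qquad A_\delta=\begin{bmatrix}\bar{\sigma}_g^f & \alpha\\ \bar{\sigma}_g^o\bar{\sigma}_g^f & \alpha\bar{\sigma}_g^o+\tfrac14\bar{\sigma}_c^x\|U_o\|\end{bmatrix}. \] If $\rho(A_\delta)<1$, then the network is incrementally input-to-state stable ($\delta$ISS): there exist $\beta_\delta\in\mathcal{KL}$ and $\gamma_\delta\in\mathcal{K}_\infty$ such that for every $k\in\mathbb{Z}_{\ge0}$, all initial states $\chi_{01},\chi_{02}\in\mathcal{X}$ and all input sequences $u_1(\cdot),u_2(\cdot)$ with values in $\mathcal{U}$, the corresponding solutions satisfy \[ \|\chi_1(k)-\chi_2(k)\|\le\beta_\delta(\|\chi_{01}-\chi_{02}\|,k)+\gamma_\delta\big(\max_{h\ge0}\|u_1(h)-u_2(h)\|\big). \]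
   Context: $\sigma_g(t)=1/(1+e^{-t})$, $\sigma_c=\tanh$, applied entrywise; $\circ$ is the Hadamard product. $\|\cdot\|$ is the Euclidean/induced 2-norm, $\|\cdot\|_\infty$ the induced $\infty$-norm, $\rho$ the spectral radius. For $\star\in\{f,i,o\}$, $\bar{\sigma}_g^\star=\sigma_g(\|[W_\star u_{\max}\ U_\star\ b_\star]\|_\infty)$ (horizontal concatenation); $\bar{\sigma}_c^c=\sigma_c(\|[W_c u_{\max}\ U_c\ b_c]\|_\infty)$; $\bar{\sigma}_c^x=\sigma_c\big(\bar{\sigma}_g^i\bar{\sigma}_c^c/(1-\bar{\sigma}_g^f)\big)$. The state set is $\mathcal{X}=\{(x,\xi):|x_{(j)}|\le\bar{\sigma}_g^i\bar{\sigma}_c^c/(1-\bar{\sigma}_g^f),\ \xi_{(j)}\in(-1,1),\ j=1,\dots,n_x\}$. $\mathcal{K},\mathcal{K}_\infty,\mathcal{KL}$ are the standard comparison-function classes. *)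

(* Defs.v *)
From HB Require Import structures.
From mathcomp Require Import all_boot all_order all_algebra.
From mathcomp Require Import all_classical all_reals all_analysis.
From mathcomp Require complex.
Import complex.ComplexField.
Set Implicit Arguments. Unset Strict Implicit. Unset Printing Implicit Defensive.
Import Order.TTheory GRing.Theory Num.Theory.
Import numFieldNormedType.Exports.
Local Open Scope classical_set_scope.
Local Open Scope ring_scope.

Section LSTMDefs.
Variable R : realType.

Definition sigmoid (t : R) : R := 1 / (1 + expR (- t)).
Definition tanhR (t : R) : R := (expR t - expR (- t)) / (expR t + expR (- t)).

Definition cmap {n} (f : R -> R) (v : 'cV[R]_n) : 'cV[R]_n := map_mx f v.
Definition hadamard {n} (v w : 'cV[R]_n) : 'cV[R]_n :=
  \col_i (v i 0 * w i 0).

Definition norm2 {n} (v : 'cV[R]_n) : R := Num.sqrt (\sum_i (v i 0) ^+ 2).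
Definition norminf {n} (v : 'cV[R]_n) : R := \big[Num.max/0]_i `|v i 0|.

Definition opnorm2 {m n} (A : 'M[R]_(m, n)) : R :=
  sup [set norm2 (A *m v) | v in [set v : 'cV[R]_n | norm2 v <= 1]].
Definition opnorminf {m n} (A : 'M[R]_(m, n)) : R :=
  sup [set norminf (A *m v) | v in [set v : 'cV[R]_n | norminf v <= 1]].

Definition specrad {n} (A : 'M[R]_n) : R :=
  sup [set complex.ComplexField.Normc.normc l | l in
        [set l : complex.complex (R : rcfType) |
           @eigenvalue (complex.complex (R : rcfType)) n
             (map_mx (fun a : R => complex.Complex a 0) A) l]].

Definition classK (a : R -> R) : Prop :=
  [/\ {within [set s : R | 0 <= s], continuous a}, a 0 = 0 &
      forall s t, 0 <= s -> s < t -> a s < a t].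
Definition classKinf (a : R -> R) : Prop :=
  classK a /\ a x @[x --> +oo] --> +oo.
Definition classKL (b : R -> nat -> R) : Prop :=
  (forall k, classK (fun s => b s k)) /\
  (forall s, 0 <= s ->
     (forall k l, (k <= l)%N -> b s l <= b s k) /\ b s k @[k --> \oo] --> 0).

Definition mat2 (a b c d : R) : 'M[R]_2 :=
  \matrix_(i < 2, j < 2)
     if i == ord0 then (if j == ord0 then a else b)
     else (if j == ord0 then c else d).

Variables (nx nu : nat).

Record lstm := LSTM {
  Wf : 'M[R]_(nx, nu); Uf : 'M[R]_nx; bf : 'cV[R]_nx;
  Wi : 'M[R]_(nx, nu); Ui : 'M[R]_nx; bi : 'cV[R]_nx;
  Wo : 'M[R]_(nx, nu); Uo : 'M[R]_nx; bo : 'cV[R]_nx;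
  Wc : 'M[R]_(nx, nu); Uc : 'M[R]_nx; bc : 'cV[R]_nx }.

Variable N : lstm.

Definition lstm_step (u : 'cV[R]_nu) (chi : 'cV[R]_nx * 'cV[R]_nx)
  : 'cV[R]_nx * 'cV[R]_nx :=
  let: (x, xi) := chi in
  let xp := hadamard (cmap sigmoid (Wf N *m u + Uf N *m xi + bf N)) x
          + hadamard (cmap sigmoid (Wi N *m u + Ui N *m xi + bi N))
                     (cmap tanhR (Wc N *m u + Uc N *m xi + bc N)) in
  (xp, hadamard (cmap sigmoid (Wo N *m u + Uo N *m xi + bo N)) (cmap tanhR xp)).

Fixpoint lstm_traj (u : nat -> 'cV[R]_nu) (chi0 : 'cV[R]_nx * 'cV[R]_nx)
  (k : nat) : 'cV[R]_nx * 'cV[R]_nx :=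
  match k with
  | 0 => chi0
  | k'.+1 => lstm_step (u k') (lstm_traj u chi0 k')
  end.

Definition state_norm (chi : 'cV[R]_nx * 'cV[R]_nx) : R :=
  norm2 (col_mx chi.1 chi.2).
Definition state_dist (chi1 chi2 : 'cV[R]_nx * 'cV[R]_nx) : R :=
  norm2 (col_mx chi1.1 chi1.2 - col_mx chi2.1 chi2.2).

Variable umax : R.

Definition gate_bound (W : 'M[R]_(nx, nu)) (U : 'M[R]_nx) (b : 'cV[R]_nx) : R :=
  opnorminf (row_mx (row_mx (umax *: W) U) b).
Definition sgf := sigmoid (gate_bound (Wf N) (Uf N) (bf N)).
Definition sgi := sigmoid (gate_bound (Wi N) (Ui N) (bi N)).
Definition sgo := sigmoid (gate_bound (Wo N) (Uo N) (bo N)).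
Definition scc := tanhR (gate_bound (Wc N) (Uc N) (bc N)).
Definition xbound := sgi * scc / (1 - sgf).
Definition scx := tanhR xbound.

Definition alpha_lstm :=
  4^-1 * opnorm2 (Uf N) * xbound + sgi * opnorm2 (Uc N)
  + 4^-1 * opnorm2 (Ui N) * scc.

Definition A_delta : 'M[R]_2 :=
  mat2 sgf alpha_lstm (sgo * sgf) (alpha_lstm * sgo + 4^-1 * scx * opnorm2 (Uo N)).

Definition in_stateset (chi : 'cV[R]_nx * 'cV[R]_nx) : Prop :=
  forall j, `|chi.1 j 0| <= xbound /\ -1 < chi.2 j 0 < 1.
Definition in_inputset (u : 'cV[R]_nu) : Prop := forall j, `|u j 0| <= umax.

Definition input_dist (u1 u2 : nat -> 'cV[R]_nu) : R :=
  sup [set norm2 (u1 h - u2 h) | h in [set: nat]].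

End LSTMDefs.

(* Main.v *)
(** The state set is invariant, so along two trajectories every gate is bounded by its
    [sgf], [sgi], [sgo] or [scc].  Since [sigmoid] is 1/4-Lipschitz and [tanhR] is
    1-Lipschitz, one step maps the pair of distances between the cell states and between
    the hidden states to a pair entrywise below its image under [A_delta] plus a multiple
    of the distance between the inputs.  The characteristic polynomial of [A_delta] is
    positive beyond the spectral radius; for a nonnegative 2x2 matrix this yields a row
    [p] of positive weights with [p *m A_delta < p], so that the weighted sum of the two
    distances contracts at each step up to the input term. *)

Require Import Defs.
From mathcomp Require Import all_boot all_order all_algebra.
From mathcomp Require Import all_classical all_reals all_analysis.
From mathcomp Require Import complex polyrcf.
From mathcomp Require Import ring lra.
Import ComplexField.
Import Order.TTheory GRing.Theory Num.Theory.
Import numFieldNormedType.Exports.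
Local Open Scope classical_set_scope.
Local Open Scope ring_scope.
Set Implicit Arguments.
Unset Strict Implicit.
Unset Printing Implicit Defensive.

Lemma cauchy_schwarz_sum (R : realDomainType) (I : finType) (f g : I -> R) :
  (\sum_i f i * g i) ^+ 2 <= (\sum_i f i ^+ 2) * (\sum_i g i ^+ 2).
Proof.
have lagrange_identity : \sum_i \sum_j (f i * g j - f j * g i) ^+ 2 =
    ((\sum_i f i ^+ 2) * (\sum_i g i ^+ 2) - (\sum_i f i * g i) ^+ 2) *+ 2.
  have -> : \sum_i \sum_j (f i * g j - f j * g i) ^+ 2 =
      \sum_i \sum_j f i ^+ 2 * g j ^+ 2
      - (\sum_i \sum_j f i * g i * (f j * g j)) *+ 2
      + \sum_i \sum_j g i ^+ 2 * f j ^+ 2.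
    rewrite -sumrMnl -sumrB -big_split; apply: eq_bigr => i _ /=.
    rewrite -sumrMnl -sumrB -big_split; apply: eq_bigr => j _ /=.
    by ring.
  by rewrite -!big_distrlr /=; ring.
rewrite -subr_ge0 -(pmulrn_lge0 _ (ltn0Sn 1)) -lagrange_identity.
by apply: sumr_ge0 => i _; apply: sumr_ge0 => j _; exact: sqr_ge0.
Qed.

Section EuclideanNorm.
Variable R : realType.

Lemma norm2_ge0 n (v : 'cV[R]_n) : 0 <= norm2 v.
Proof. exact: sqrtr_ge0. Qed.

Lemma sqr_norm2 n (v : 'cV[R]_n) : norm2 v ^+ 2 = \sum_i v i 0 ^+ 2.
Proof. by rewrite sqr_sqrtr // sumr_ge0 // => i _; exact: sqr_ge0. Qed.

Lemma norm2_0 n : norm2 (0 : 'cV[R]_n) = 0.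
Proof. by rewrite /norm2 big1 ?sqrtr0 // => i _; rewrite mxE expr0n. Qed.

Lemma norm_coord_le_norm2 n (v : 'cV[R]_n) i : `|v i 0| <= norm2 v.
Proof.
rewrite -ler_sqr ?nnegrE ?norm2_ge0 // sqr_norm2 real_normK ?num_real //.
by rewrite (bigD1 i) //= lerDl sumr_ge0 // => j _; exact: sqr_ge0.
Qed.

Lemma norm2_0_eq0 n (v : 'cV[R]_n) : norm2 v = 0 -> v = 0.
Proof.
move=> v0; apply/matrixP => i j; rewrite ord1 mxE.
by apply/eqP; rewrite -normr_le0 -v0 norm_coord_le_norm2.
Qed.

Lemma norm2_le_coord n (v w : 'cV[R]_n) (k : R) : 0 <= k ->
  (forall i, `|v i 0| <= k * `|w i 0|) -> norm2 v <= k * norm2 w.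
Proof.
move=> k0 vw; rewrite -ler_sqr ?nnegrE ?mulr_ge0 ?norm2_ge0 //.
rewrite exprMn !sqr_norm2 mulr_sumr; apply: ler_sum => i _.
rewrite -[v i 0 ^+ 2]real_normK ?num_real // -[w i 0 ^+ 2]real_normK ?num_real //.
by rewrite -exprMn lerXn2r ?nnegrE ?mulr_ge0.
Qed.

Lemma norm2Z n (a : R) (v : 'cV[R]_n) : norm2 (a *: v) = `|a| * norm2 v.
Proof.
rewrite /norm2 -sqrtr_sqr -sqrtrM ?sqr_ge0 // mulr_sumr.
by congr Num.sqrt; apply: eq_bigr => i _; rewrite mxE exprMn.
Qed.

Lemma ler_norm2D n (v w : 'cV[R]_n) : norm2 (v + w) <= norm2 v + norm2 w.
Proof.
have inner_le : \sum_i v i 0 * w i 0 <= norm2 v * norm2 w.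
  apply: le_trans (ler_norm _) _.
  rewrite -ler_sqr ?nnegrE ?mulr_ge0 ?norm2_ge0 // real_normK ?num_real //.
  by rewrite exprMn !sqr_norm2 cauchy_schwarz_sum.
rewrite -ler_sqr ?nnegrE ?addr_ge0 ?norm2_ge0 // sqrrD !sqr_norm2.
have -> : \sum_i (v + w) i 0 ^+ 2 =
    \sum_i v i 0 ^+ 2 + (\sum_i v i 0 * w i 0) *+ 2 + \sum_i w i 0 ^+ 2.
  rewrite -sumrMnl -!big_split; apply: eq_bigr => i _ /=.
  by rewrite mxE sqrrD.
by rewrite lerD2r lerD2l lerMn2r inner_le.
Qed.

Lemma norm2_le_sum n (v : 'cV[R]_n) : norm2 v <= \sum_i `|v i 0|.
Proof.
rewrite -ler_sqr ?nnegrE ?norm2_ge0 ?sumr_ge0 // sqr_norm2 expr2 mulr_suml.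
apply: ler_sum => i _; rewrite -real_normK ?num_real // expr2.
by rewrite ler_wpM2l // (bigD1 i) //= lerDl sumr_ge0.
Qed.

Lemma sqr_norm2_col_mx m n (v : 'cV[R]_m) (w : 'cV[R]_n) :
  norm2 (col_mx v w) ^+ 2 = norm2 v ^+ 2 + norm2 w ^+ 2.
Proof.
rewrite !sqr_norm2 big_split_ord /=.
by congr (_ + _); apply: eq_bigr => i _; rewrite ?col_mxEu ?col_mxEd.
Qed.

Lemma norm2_col_mx_le m n (v : 'cV[R]_m) (w : 'cV[R]_n) :
  norm2 (col_mx v w) <= norm2 v + norm2 w.
Proof.
rewrite -ler_sqr ?nnegrE ?addr_ge0 ?norm2_ge0 // sqr_norm2_col_mx sqrrD.
by rewrite -addrA lerD2l lerDr mulrn_wge0 // mulr_ge0 ?norm2_ge0.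
Qed.

Lemma norm2_le_col_mxu m n (v : 'cV[R]_m) (w : 'cV[R]_n) :
  norm2 v <= norm2 (col_mx v w).
Proof.
by rewrite -ler_sqr ?nnegrE ?norm2_ge0 // sqr_norm2_col_mx lerDl sqr_ge0.
Qed.

Lemma norm2_le_col_mxd m n (v : 'cV[R]_m) (w : 'cV[R]_n) :
  norm2 w <= norm2 (col_mx v w).
Proof.
by rewrite -ler_sqr ?nnegrE ?norm2_ge0 // sqr_norm2_col_mx lerDr sqr_ge0.
Qed.

End EuclideanNorm.

Section InducedNorms.
Variable R : realType.

Lemma norminf_ge0 n (v : 'cV[R]_n) : 0 <= norminf v.
Proof. exact: bigmax_ge_id. Qed.

Lemma norm_coord_le_norminf n (v : 'cV[R]_n) i : `|v i 0| <= norminf v.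
Proof. exact: (le_bigmax _ (fun i => `|v i 0|)). Qed.

Lemma norminf_le n (v : 'cV[R]_n) (r : R) : 0 <= r ->
  (forall i, `|v i 0| <= r) -> norminf v <= r.
Proof. by move=> r0 vr; apply: bigmax_le. Qed.

Lemma norminf_0 n : norminf (0 : 'cV[R]_n) = 0.
Proof.
apply/eqP; rewrite eq_le norminf_ge0 andbT.
by apply: norminf_le => // i; rewrite mxE normr0.
Qed.

Lemma norminf_le_norm2 n (v : 'cV[R]_n) : norminf v <= norm2 v.
Proof. by apply: norminf_le => [|i]; [exact: norm2_ge0|exact: norm_coord_le_norm2]. Qed.

Lemma norminf_col_mx_le m n (v : 'cV[R]_m) (w : 'cV[R]_n) (r : R) :
  norminf v <= r -> norminf w <= r -> norminf (col_mx v w) <= r.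
Proof.
move=> vr wr; apply: norminf_le => [|i]; first exact: le_trans (norminf_ge0 v) vr.
rewrite mxE; case: splitP => j _.
- exact: le_trans (norm_coord_le_norminf v j) vr.
- exact: le_trans (norm_coord_le_norminf w j) wr.
Qed.

Lemma norm2_mulmx_le_sum m n (A : 'M[R]_(m, n)) (v : 'cV[R]_n) :
  norminf v <= 1 -> norm2 (A *m v) <= \sum_i \sum_j `|A i j|.
Proof.
move=> v1; apply: le_trans (norm2_le_sum _) _; apply: ler_sum => i _.
rewrite mxE; apply: le_trans (ler_norm_sum _ _ _) _; apply: ler_sum => j _.
by rewrite normrM ler_piMr // (le_trans (norm_coord_le_norminf v j)).
Qed.

Lemma norm2_mulmx_unit_ball m n (A : 'M[R]_(m, n)) (v : 'cV[R]_n) :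
  norm2 v <= 1 -> norm2 (A *m v) <= opnorm2 A.
Proof.
move=> v1; apply: ub_le_sup; last by exists v.
exists (\sum_i \sum_j `|A i j|) => _ [w /= w1 <-].
exact/norm2_mulmx_le_sum/(le_trans (norminf_le_norm2 w)).
Qed.

Lemma opnorm2_ge0 m n (A : 'M[R]_(m, n)) : 0 <= opnorm2 A.
Proof.
apply: le_trans (norm2_ge0 (A *m 0)) _.
by apply: norm2_mulmx_unit_ball; rewrite norm2_0.
Qed.

Lemma norm2_mulmx m n (A : 'M[R]_(m, n)) (v : 'cV[R]_n) :
  norm2 (A *m v) <= opnorm2 A * norm2 v.
Proof.
have [/norm2_0_eq0 ->|v_neq0] := eqVneq (norm2 v) 0.
  by rewrite mulmx0 !norm2_0 mulr0.
have v_gt0 : 0 < norm2 v by rewrite lt_def v_neq0 norm2_ge0.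
rewrite -ler_pdivrMr // mulrC -[(norm2 v)^-1]ger0_norm ?invr_ge0 ?norm2_ge0 //.
rewrite -norm2Z scalemxAr norm2_mulmx_unit_ball //.
by rewrite norm2Z ger0_norm ?invr_ge0 ?norm2_ge0 // mulVf.
Qed.

Lemma norminf_mulmx_unit_ball m n (A : 'M[R]_(m, n)) (v : 'cV[R]_n) :
  norminf v <= 1 -> norminf (A *m v) <= opnorminf A.
Proof.
move=> v1; apply: ub_le_sup; last by exists v.
exists (\sum_i \sum_j `|A i j|) => _ [w /= w1 <-].
exact: le_trans (norminf_le_norm2 _) (norm2_mulmx_le_sum A w1).
Qed.

Lemma opnorminf_ge0 m n (A : 'M[R]_(m, n)) : 0 <= opnorminf A.
Proof.
apply: le_trans (norminf_ge0 (A *m 0)) _.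
by apply: norminf_mulmx_unit_ball; rewrite norminf_0.
Qed.

End InducedNorms.

Lemma lipschitzP (K : numFieldType) (V W : normedModType K) (k : K) (f : V -> W) :
  k.-lipschitz f <-> forall x y, `|f x - f y| <= k * `|x - y|.
Proof.
by split=> [f_lip x y|f_lip [x y] _]; [exact: (f_lip (x, y) (conj I I))|exact: f_lip].
Qed.

Section Activations.
Variable R : realType.
Implicit Types (s t : R) (f : R -> R).

Lemma is_derive_bounded_lipschitz f (df : R -> R) (k : R) :
  (forall t, is_derive t 1 f (df t)) -> (forall t, `|df t| <= k) -> k.-lipschitz f.
Proof.
move=> f_df df_le; apply/lipschitzP => s t; wlog st : s t / s <= t.
  move=> le_case; have [/le_case //|/ltW/le_case] := leP s t.
  by rewrite distrC (distrC t).
have [r _ ftE] : exists2 r, r \in `[s, t] & f t - f s = df r * (t - s).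
  apply: (MVT_segment st) => //.
  by apply: derivable_within_continuous => r _; have [] := f_df r.
by rewrite distrC ftE normrM (distrC s) ler_wpM2r.
Qed.

Lemma sigmoid_gt0 t : 0 < sigmoid t.
Proof. by rewrite divr_gt0 // addr_gt0 ?expR_gt0. Qed.

Lemma sigmoid_lt1 t : sigmoid t < 1.
Proof. by rewrite ltr_pdivrMr ?addr_gt0 ?expR_gt0 // mul1r ltrDl expR_gt0. Qed.

Lemma ler_sigmoid : {mono @sigmoid R : s t / s <= t}.
Proof.
move=> s t; rewrite /sigmoid !div1r lef_pV2 ?posrE ?addr_gt0 ?expR_gt0 //.
by rewrite lerD2l ler_expR lerN2.
Qed.

Lemma is_derive_sigmoid t :
  is_derive t 1 (@sigmoid R) (sigmoid t * (1 - sigmoid t)).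
Proof.
have denom_neq0 : 1 + expR (- t) != 0 by rewrite gt_eqF // addr_gt0 ?expR_gt0.
have expN_deriv : is_derive t 1 (fun s : R => expR (- s)) (- expR (- t)).
  have := is_derive1_comp (is_derive_expR (- t)) (is_deriveNid t 1).
  by rewrite /= mulrN1.
have denom_deriv : is_derive t 1 (fun s : R => 1 + expR (- s)) (- expR (- t)).
  by have := is_deriveD (is_derive_cst (1 : R) t 1) expN_deriv; rewrite add0r.
have -> : @sigmoid R = fun s => (1 + expR (- s))^-1.
  by apply/funext => s; rewrite /sigmoid div1r.
apply: (is_derive_eq (is_deriveV (f := fun s => 1 + expR (- s)) denom_neq0 denom_deriv)).
by rewrite /GRing.scale /=; field.
Qed.

Lemma lipschitz_sigmoid : (4^-1 : R).-lipschitz (@sigmoid R).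
Proof.
apply: (is_derive_bounded_lipschitz is_derive_sigmoid) => t.
have s0 := sigmoid_gt0 t; have s1 := sigmoid_lt1 t.
rewrite gtr0_norm ?mulr_gt0 ?subr_gt0 //.
by have := sqr_ge0 (sigmoid t - 2^-1); lra.
Qed.

Lemma norm_sigmoid_le t r : `|t| <= r -> `|sigmoid t| <= sigmoid r.
Proof.
by move=> /(le_trans (ler_norm t)); rewrite gtr0_norm ?sigmoid_gt0 // ler_sigmoid.
Qed.

Lemma tanhR_sigmoid t : tanhR t = 2 * sigmoid (2 * t) - 1.
Proof.
have e0 := expR_gt0 t; have exp2N : expR (- (2 * t)) = expR (- t) * expR (- t).
  by rewrite -expRD; congr expR; ring.
rewrite /tanhR /sigmoid exp2N expRN; field.
by rewrite !gt_eqF // ?addr_gt0 ?mulr_gt0.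
Qed.

Lemma norm_tanhR_lt1 t : `|tanhR t| < 1.
Proof.
have s0 := sigmoid_gt0 (2 * t); have s1 := sigmoid_lt1 (2 * t).
by rewrite tanhR_sigmoid ltr_norml; apply/andP; split; lra.
Qed.

Lemma lipschitz_tanhR : (1 : R).-lipschitz (@tanhR R).
Proof.
apply/lipschitzP => s t; have /lipschitzP/(_ (2 * s) (2 * t)) := lipschitz_sigmoid.
have -> : tanhR s - tanhR t = 2 * (sigmoid (2 * s) - sigmoid (2 * t)).
  by rewrite !tanhR_sigmoid; ring.
by rewrite -(mulrBr 2 s) !(normrM 2) normr_nat mul1r; lra.
Qed.

Lemma ler_tanhR : {mono @tanhR R : s t / s <= t}.
Proof.
by move=> s t; rewrite !tanhR_sigmoid lerD2r ler_pM2l // ler_sigmoid ler_pM2l.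
Qed.

Lemma tanhRN t : tanhR (- t) = - tanhR t.
Proof. by rewrite /tanhR opprK -mulNr opprB [X in _ / X]addrC. Qed.

Lemma norm_tanhR_le t r : `|t| <= r -> `|tanhR t| <= tanhR r.
Proof. by rewrite !ler_norml -tanhRN !ler_tanhR. Qed.

Lemma tanhR_ge0 t : 0 <= t -> 0 <= tanhR t.
Proof.
move=> t0; apply: le_trans (normr_ge0 (tanhR t)) _.
by rewrite norm_tanhR_le // ger0_norm.
Qed.

End Activations.

Section EntrywiseOrder.
Variable R : numDomainType.

Definition lemx m n (A B : 'M[R]_(m, n)) : Prop := forall i j, A i j <= B i j.

Lemma lemx_wpM2l m n p (C : 'M[R]_(m, n)) (A B : 'M[R]_(n, p)) :
  lemx 0 C -> lemx A B -> lemx (C *m A) (C *m B).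
Proof.
move=> C0 AB i j; rewrite !mxE; apply: ler_sum => k _.
by rewrite ler_wpM2l //; have := C0 i k; rewrite mxE.
Qed.

Lemma lemx_wpM2r m n p (C : 'M[R]_(n, p)) (A B : 'M[R]_(m, n)) :
  lemx 0 C -> lemx A B -> lemx (A *m C) (B *m C).
Proof.
move=> C0 AB i j; rewrite !mxE; apply: ler_sum => k _.
by rewrite ler_wpM2r //; have := C0 k j; rewrite mxE.
Qed.

End EntrywiseOrder.

Section SpectralRadius.
Variable R : realType.

Lemma specrad_ge n (A : 'M[R]_n) (r : R) : eigenvalue A r -> r <= specrad A.
Proof.
move=> Ar; pose f := complex.real_complex R.
have fAr : eigenvalue (map_mx f A) (f r) by rewrite eigenvalue_map.
apply: (@le_trans _ _ (Normc.normc (f r))).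
  by rewrite /= expr0n addr0 sqrtr_sqr ler_norm.
apply: ub_le_sup; last by exists (f r).
have [rs rsE] := closed_field_poly_normal (char_poly (map_mx f A)).
exists (\sum_(z <- rs) Normc.normc z) => _ [l /= + <-].
rewrite eigenvalue_root_char rsE (monicP (char_poly_monic _)) scale1r.
rewrite root_prod_XsubC => l_rs.
by rewrite (big_rem l) //= lerDl; apply: sumr_ge0 => -[x y] _; exact: sqrtr_ge0.
Qed.

Lemma char_poly_gt0 n (A : 'M[R]_n) (t : R) :
  specrad A < t -> 0 < (char_poly A).[t].
Proof.
move=> At; rewrite ltNge; apply/negP => pt_le0.
have lead_coef_eq1 : lead_coef (char_poly A) = 1 by exact/monicP/char_poly_monic.
have [|b b_large] := @poly_pinfty_gt_lc _ (char_poly A); first by rewrite lead_coef_eq1.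
have pb_ge0 : 0 <= (char_poly A).[Num.max t b].
  by apply: le_trans (b_large _ _); rewrite ?lead_coef_eq1 // le_max lexx orbT.
have [||r /andP[tr _] Ar] := @poly_ivt _ (char_poly A) t (Num.max t b).
- by rewrite le_max lexx.
- by rewrite pt_le0.
have := specrad_ge (A := A) (r := r); rewrite eigenvalue_root_char => /(_ Ar).
by move=> /(le_trans tr); rewrite leNgt At.
Qed.

End SpectralRadius.

Lemma forall_ord2 (P : 'I_2 -> Prop) : P 0 -> P 1 -> forall i, P i.
Proof.
move=> P0 P1; case=> [[|[|//]] lti2].
- by rewrite (_ : Ordinal _ = 0) //; exact: val_inj.
- by rewrite (_ : Ordinal _ = 1) //; exact: val_inj.
Qed.

Lemma sum_ord2 (V : nmodType) (F : 'I_2 -> V) : \sum_i F i = F 0 + F 1.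
Proof. by rewrite big_ord_recl big_ord1; congr (_ + F _); exact: val_inj. Qed.

Lemma horner_char_poly_mx2 (R : comNzRingType) (A : 'M[R]_2) (t : R) :
  (char_poly A).[t] = (t - A 0 0) * (t - A 1 1) - A 0 1 * A 1 0.
Proof.
rewrite /char_poly (expand_det_row _ ord0) sum_ord2 /cofactor.
have lift01 : lift (0 : 'I_2) (0 : 'I_1) = 1 by exact: val_inj.
have lift10 : lift (1 : 'I_2) (0 : 'I_1) = 0 by exact: val_inj.
by rewrite !det_mx11 !mxE lift01 lift10 /= !hornerE /=; ring.
Qed.

(* The weights are the row vector [(1, 1) *m \adj (1 - A)]. *)
Lemma nonneg_mx2_decreasing_weights (R : realType) (A : 'M[R]_2) :
  lemx 0 A -> specrad A < 1 ->
  exists2 p : 'rV[R]_2, forall i, 0 < p 0 i & forall j, (p *m A) 0 j < p 0 j.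
Proof.
move=> A0 A1.
have entry_ge0 i j : 0 <= A i j by have := A0 i j; rewrite mxE.
have offdiag_prod_ge0 : 0 <= A 0 1 * A 1 0 by rewrite mulr_ge0.
have charP t : 1 <= t -> 0 < (t - A 0 0) * (t - A 1 1) - A 0 1 * A 1 0.
  by rewrite -horner_char_poly_mx2 => t1; exact: char_poly_gt0 (lt_le_trans A1 t1).
have diag_lt1 : forall i, A i i < 1.
  apply: forall_ord2; rewrite ltNge; apply/negP => /charP.
    by rewrite subrr mul0r sub0r oppr_gt0 ltNge offdiag_prod_ge0.
  by rewrite subrr mulr0 sub0r oppr_gt0 ltNge offdiag_prod_ge0.
have det_gt0 := charP 1 (lexx 1).
exists (\row_j if j == 0 then 1 - A 1 1 + A 1 0 else 1 - A 0 0 + A 0 1).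
- by apply: forall_ord2; rewrite mxE /= ltr_wpDr ?entry_ge0 // subr_gt0.
- by apply: forall_ord2; rewrite !mxE sum_ord2 !mxE /=; lra.
Qed.

Lemma affine_recursion_bound (R : numFieldType) (V : nat -> R) (l e : R) :
  0 < l < 1 -> 0 <= e ->
  (forall k, V k.+1 <= l * V k + e) ->
  forall k, V k <= l ^+ k * V 0%N + e / (1 - l).
Proof.
move=> /andP[l0 l1] e0 V_rec.
have onem_gt0 : 0 < 1 - l by rewrite subr_gt0.
have fixpointE : e / (1 - l) = l * (e / (1 - l)) + e by field; rewrite gt_eqF.
elim=> [|k IH]; first by rewrite expr0 mul1r lerDl divr_ge0 // ltW.
apply: le_trans (V_rec k) _; rewrite fixpointE addrA lerD2r exprS -mulrA -mulrDr.
by rewrite ler_wpM2l // ltW.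
Qed.

Section LinearComparison.
Variable R : realFieldType.

Lemma decreasing_weights_factor n (A : 'M[R]_n) (p : 'rV[R]_n) :
  (forall i, 0 < p 0 i) -> (forall j, (p *m A) 0 j < p 0 j) ->
  exists2 l : R, 0 < l < 1 & lemx (p *m A) (l *: p).
Proof.
move=> p0 pA; exists (\big[Num.max/2^-1]_j ((p *m A) 0 j / p 0 j)).
  apply/andP; split; first by apply: lt_le_trans (bigmax_ge_id _ _ _ _); rewrite invr_gt0.
  by apply: bigmax_lt => [|j _]; [lra|rewrite ltr_pdivrMr // mul1r].
move=> i j; rewrite ord1 [leRHS]mxE -ler_pdivrMr //.
exact: (le_bigmax _ (fun j => (p *m A) 0 j / p 0 j)).
Qed.

Lemma weighted_sum_equiv n (p : 'rV[R]_n) : (forall i, 0 < p 0 i) ->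
  exists m M : R, [/\ 0 < m, 0 < M & forall v : 'cV[R]_n, lemx 0 v ->
    m * (\sum_i v i 0) <= (p *m v) 0 0 <= M * (\sum_i v i 0)].
Proof.
move=> p0; exists (\big[Num.min/1]_i p 0 i), (\big[Num.max/1]_i p 0 i); split.
- by apply: lt_bigmin.
- exact: lt_le_trans (bigmax_ge_id _ _ _ _).
move=> v v0; have v_ge0 i : 0 <= v i 0 by have := v0 i 0; rewrite mxE.
rewrite mxE !mulr_sumr; apply/andP; split; apply: ler_sum => i _.
- by rewrite ler_wpM2r // bigmin_le.
- by rewrite ler_wpM2r // (le_bigmax _ (p 0)).
Qed.

Lemma comparison_geometric_bound n (A : 'M[R]_n) (p : 'rV[R]_n) (l : R) :
  (forall i, 0 < p 0 i) -> 0 < l < 1 -> lemx (p *m A) (l *: p) ->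
  exists2 C : R, 0 < C & forall (z : nat -> 'cV[R]_n) (e : 'cV[R]_n),
    (forall k, lemx 0 (z k)) -> lemx 0 e ->
    (forall k, lemx (z k.+1) (A *m z k + e)) ->
    forall k, \sum_i z k i 0 <=
      C * (l ^+ k * (\sum_i z 0%N i 0) + (\sum_i e i 0) / (1 - l)).
Proof.
move=> p0 l01 pA; have [m [M [m0 M0 p_equiv]]] := weighted_sum_equiv p0.
have /andP[l0 l1] := l01.
have p_ge0 : lemx 0 p by move=> i j; rewrite ord1 mxE ltW.
exists (M / m); first by rewrite divr_gt0.
move=> z e z0 e0 z_rec k; pose V k := (p *m z k) 0 0.
have /andP[pe_ge pe_le] := p_equiv e e0.
have pe_ge0 : 0 <= (p *m e) 0 0.
  apply: le_trans pe_ge; apply: mulr_ge0 (ltW m0) _; apply: sumr_ge0 => i _.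
  by have := e0 i 0; rewrite mxE.
have V_rec j : V j.+1 <= l * V j + (p *m e) 0 0.
  apply: le_trans (lemx_wpM2l p_ge0 (z_rec j) 0 0) _.
  rewrite mulmxDr mulmxA mxE lerD2r.
  by apply: le_trans (lemx_wpM2r (z0 j) pA 0 0) _; rewrite -scalemxAl mxE.
rewrite mulrAC ler_pdivlMr // mulrC.
have /andP[+ _] := p_equiv _ (z0 k); move=> /le_trans; apply.
apply: le_trans (affine_recursion_bound l01 pe_ge0 V_rec k) _.
rewrite mulrDr mulrCA [M * (_ / _)]mulrA lerD //.
- by rewrite ler_wpM2l ?exprn_ge0 ?(ltW l0) //; have /andP[] := p_equiv _ (z0 0%N).
- by rewrite ler_wpM2r // invr_ge0 subr_ge0 ltW.
Qed.

End LinearComparison.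

Section ComparisonFunctions.
Variable R : realType.

Lemma classK_linear (a : R) : 0 < a -> classK (fun s => a * s).
Proof.
move=> a0; split; rewrite ?mulr0 //.
  by apply: continuous_subspaceT; exact: mulrl_continuous.
by move=> s t _ st; rewrite ltr_pM2l.
Qed.

Lemma classKinf_linear (a : R) : 0 < a -> classKinf (fun s => a * s).
Proof.
move=> a0; split; first exact: classK_linear.
by apply: gt0_cvgMry => //; exact: cvg_id.
Qed.

Lemma classKL_geometric (a l : R) : 0 < a -> 0 < l < 1 ->
  classKL (fun s k => a * l ^+ k * s).
Proof.
move=> a0 /andP[l0 l1]; split=> [k|s s0].
  by apply: classK_linear; rewrite mulr_gt0 ?exprn_gt0.
split=> [k m km|].
  by rewrite ler_wpM2r // ler_pM2l // ler_wiXn2l // ltW.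
have -> : (fun k => a * l ^+ k * s) = geometric (a * s) l.
  by apply/funext => k; rewrite /geometric /= mulrAC.
by apply: cvg_geometric; rewrite ger0_norm // ltW.
Qed.

End ComparisonFunctions.

Section Gates.
Variables (R : realType) (nx nu : nat).
Implicit Types (f : R -> R) (W : 'M[R]_(nx, nu)) (U : 'M[R]_nx) (b xi : 'cV[R]_nx).
Implicit Types (u : 'cV[R]_nu).

Definition gate f W U b u xi : 'cV[R]_nx := cmap f (W *m u + U *m xi + b).

Lemma cmapE n f (v : 'cV[R]_n) i : cmap f v i 0 = f (v i 0).
Proof. by rewrite mxE. Qed.

Lemma hadamardE n (v w : 'cV[R]_n) i : hadamard v w i 0 = v i 0 * w i 0.
Proof. by rewrite mxE. Qed.

Lemma norm2_cmapB n f (k : R) (v w : 'cV[R]_n) : k.-lipschitz f ->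
  norm2 (cmap f v - cmap f w) <= k * norm2 (v - w).
Proof.
move=> /lipschitzP f_lip; apply: norm2_le_coord => [|i]; last by rewrite !mxE.
by have := f_lip 1 0; rewrite subr0 normr1 mulr1; exact: le_trans.
Qed.

Lemma norm2_hadamardB n (a1 a2 b1 b2 : 'cV[R]_n) (r s : R) : 0 <= r -> 0 <= s ->
  (forall i, `|a1 i 0| <= r) -> (forall i, `|b2 i 0| <= s) ->
  norm2 (hadamard a1 b1 - hadamard a2 b2)
  <= r * norm2 (b1 - b2) + s * norm2 (a1 - a2).
Proof.
move=> r0 s0 a1r b2s.
have -> : hadamard a1 b1 - hadamard a2 b2
    = hadamard a1 (b1 - b2) + hadamard (a1 - a2) b2.
  by apply/matrixP => i j; rewrite !mxE; ring.
apply: le_trans (ler_norm2D _ _) _; apply: lerD; apply: norm2_le_coord => // i.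
- by rewrite mxE normrM ler_wpM2r.
- by rewrite mxE normrM mulrC ler_wpM2r.
Qed.

(* For [umax = 0] the input is [0], and so is [umax^-1]. *)
Lemma inputset_rescale (umax : R) u : in_inputset umax u ->
  exists2 w : 'cV[R]_nu, norminf w <= 1 & u = umax *: w.
Proof.
move=> uU; exists (umax^-1 *: u).
  apply: norminf_le => // i; rewrite mxE normrM normfV.
  have [->|umax_neq0] := eqVneq umax 0; first by rewrite normr0 invr0 mul0r.
  by rewrite mulrC ler_pdivrMr ?normr_gt0 // mul1r (le_trans (uU i)) ?ler_norm.
have [umax0|umax_neq0] := eqVneq umax 0; last by rewrite scalerA divff // scale1r.
apply/matrixP => i j; rewrite ord1 umax0 scale0r mxE.
by apply/eqP; rewrite -normr_le0 -umax0.
Qed.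

Lemma norm_preactivation_le (umax : R) W U b u xi i :
  in_inputset umax u -> norminf xi <= 1 ->
  `|(W *m u + U *m xi + b) i 0| <= gate_bound umax W U b.
Proof.
move=> /inputset_rescale[w w1 ->] xi1.
have -> : W *m (umax *: w) + U *m xi + b =
    row_mx (row_mx (umax *: W) U) b *m col_mx (col_mx w xi) (1%:M : 'M[R]_1).
  by rewrite !mul_row_col mulmx1 -scalemxAl -scalemxAr.
apply: le_trans (norm_coord_le_norminf _ _) _.
apply: norminf_mulmx_unit_ball; rewrite !norminf_col_mx_le //.
by apply: norminf_le => // j; rewrite ord1 mxE normr1.
Qed.

Lemma norm_gate_le f (umax : R) W U b u xi i :
  (forall t r, `|t| <= r -> `|f t| <= f r) ->
  in_inputset umax u -> norminf xi <= 1 ->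
  `|gate f W U b u xi i 0| <= f (gate_bound umax W U b).
Proof. by move=> f_norm uU xi1; rewrite cmapE; exact/f_norm/norm_preactivation_le. Qed.

Lemma norm2_gateB f (k : R) W U b u1 u2 xi1 xi2 : 0 <= k -> k.-lipschitz f ->
  norm2 (gate f W U b u1 xi1 - gate f W U b u2 xi2)
  <= k * (opnorm2 W * norm2 (u1 - u2) + opnorm2 U * norm2 (xi1 - xi2)).
Proof.
move=> k0 /norm2_cmapB/le_trans; apply; rewrite ler_wpM2l //.
have -> : (W *m u1 + U *m xi1 + b) - (W *m u2 + U *m xi2 + b)
    = W *m (u1 - u2) + U *m (xi1 - xi2).
  by rewrite !mulmxBr opprD addrACA subrr addr0 opprD addrACA.
by apply: le_trans (ler_norm2D _ _) _; apply: lerD; exact: norm2_mulmx.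
Qed.

Lemma le_input_dist (umax : R) (u1 u2 : nat -> 'cV[R]_nu) h :
  (forall k, in_inputset umax (u1 k)) -> (forall k, in_inputset umax (u2 k)) ->
  norm2 (u1 h - u2 h) <= input_dist u1 u2.
Proof.
move=> uU1 uU2; apply: ub_le_sup; last by exists h.
exists (\sum_(j < nu) (umax + umax)) => _ [k _ <-].
apply: le_trans (norm2_le_sum _) _; apply: ler_sum => j _; rewrite !mxE.
by apply: le_trans (ler_normB _ _) _; apply: lerD; [exact: uU1|exact: uU2].
Qed.

End Gates.

Section StateGap.
Variables (R : realType) (nx : nat).
Implicit Types chi : 'cV[R]_nx * 'cV[R]_nx.

Definition state_gap chi1 chi2 : 'cV[R]_2 :=
  \col_i if i == 0 then norm2 (chi1.1 - chi2.1) else norm2 (chi1.2 - chi2.2).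

Lemma state_gap_ge0 chi1 chi2 : lemx 0 (state_gap chi1 chi2).
Proof. by move=> i j; rewrite !mxE; case: ifP => _; exact: norm2_ge0. Qed.

Lemma state_dist_le_sum_gap chi1 chi2 :
  state_dist chi1 chi2 <= \sum_i state_gap chi1 chi2 i 0.
Proof.
rewrite sum_ord2 !mxE /= /state_dist opp_col_mx add_col_mx.
exact: norm2_col_mx_le.
Qed.

Lemma sum_gap_le_state_dist chi1 chi2 :
  \sum_i state_gap chi1 chi2 i 0 <= 2 * state_dist chi1 chi2.
Proof.
rewrite sum_ord2 !mxE /= /state_dist opp_col_mx add_col_mx mulr_natl mulr2n.
by apply: lerD; [exact: norm2_le_col_mxu|exact: norm2_le_col_mxd].
Qed.

End StateGap.

Section Network.
Variables (R : realType) (nx nu : nat) (N : lstm R nx nu) (umax : R).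
Implicit Types (u : 'cV[R]_nu) (chi : 'cV[R]_nx * 'cV[R]_nx).

Let quarter_ge0 : 0 <= 4^-1 :> R. Proof. by rewrite invr_ge0. Qed.

Lemma sgf_ge0 : 0 <= sgf N umax. Proof. exact/ltW/sigmoid_gt0. Qed.

Lemma sgi_ge0 : 0 <= sgi N umax. Proof. exact/ltW/sigmoid_gt0. Qed.

Lemma sgo_ge0 : 0 <= sgo N umax. Proof. exact/ltW/sigmoid_gt0. Qed.

Lemma scc_ge0 : 0 <= scc N umax. Proof. exact/tanhR_ge0/opnorminf_ge0. Qed.

Lemma xbound_ge0 : 0 <= xbound N umax.
Proof.
apply: divr_ge0; first exact: mulr_ge0 sgi_ge0 scc_ge0.
by rewrite subr_ge0; exact/ltW/sigmoid_lt1.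
Qed.

Lemma scx_ge0 : 0 <= scx N umax. Proof. exact/tanhR_ge0/xbound_ge0. Qed.

Lemma xbound_fixpoint :
  xbound N umax = sgf N umax * xbound N umax + sgi N umax * scc N umax.
Proof.
have : 1 - sgf N umax != 0 by rewrite gt_eqF // subr_gt0 sigmoid_lt1.
by rewrite /xbound => ?; field.
Qed.

Definition forget_gate u chi := gate (@sigmoid R) (Wf N) (Uf N) (bf N) u chi.2.
Definition input_gate u chi := gate (@sigmoid R) (Wi N) (Ui N) (bi N) u chi.2.
Definition output_gate u chi := gate (@sigmoid R) (Wo N) (Uo N) (bo N) u chi.2.
Definition candidate u chi := gate (@tanhR R) (Wc N) (Uc N) (bc N) u chi.2.

Lemma lstm_step_cellE u chi : (lstm_step N u chi).1 =
  hadamard (forget_gate u chi) chi.1 + hadamard (input_gate u chi) (candidate u chi).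
Proof. by case: chi. Qed.

Lemma lstm_step_hiddenE u chi : (lstm_step N u chi).2 =
  hadamard (output_gate u chi) (cmap (@tanhR R) (lstm_step N u chi).1).
Proof. by case: chi. Qed.

Lemma norm_lstm_step_hidden_lt1 u chi j : `|(lstm_step N u chi).2 j 0| < 1.
Proof.
rewrite lstm_step_hiddenE hadamardE !cmapE normrM.
apply: le_lt_trans (norm_tanhR_lt1 ((lstm_step N u chi).1 j 0)).
by rewrite ler_piMl // gtr0_norm ?sigmoid_gt0 // ltW // sigmoid_lt1.
Qed.

Section AdmissibleState.
Variables (u : 'cV[R]_nu) (chi : 'cV[R]_nx * 'cV[R]_nx).
Hypotheses (uU : in_inputset umax u) (chiX : in_stateset N umax chi).

Lemma stateset_norminf_hidden : norminf chi.2 <= 1.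
Proof.
apply: norminf_le => // j; have [_ /andP[lo hi]] := chiX j.
by rewrite ler_norml !ltW.
Qed.

Lemma norm_forget_gate_le i : `|forget_gate u chi i 0| <= sgf N umax.
Proof. exact: norm_gate_le (@norm_sigmoid_le R) uU stateset_norminf_hidden. Qed.

Lemma norm_input_gate_le i : `|input_gate u chi i 0| <= sgi N umax.
Proof. exact: norm_gate_le (@norm_sigmoid_le R) uU stateset_norminf_hidden. Qed.

Lemma norm_output_gate_le i : `|output_gate u chi i 0| <= sgo N umax.
Proof. exact: norm_gate_le (@norm_sigmoid_le R) uU stateset_norminf_hidden. Qed.

Lemma norm_candidate_le i : `|candidate u chi i 0| <= scc N umax.
Proof. exact: norm_gate_le (@norm_tanhR_le R) uU stateset_norminf_hidden. Qed.

Lemma norm_lstm_step_cell_le j : `|(lstm_step N u chi).1 j 0| <= xbound N umax.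
Proof.
have [xj _] := chiX j; rewrite lstm_step_cellE mxE !hadamardE xbound_fixpoint.
apply: le_trans (ler_normD _ _) _; apply: lerD; rewrite normrM; apply: ler_pM => //.
- exact: norm_forget_gate_le.
- exact: norm_input_gate_le.
- exact: norm_candidate_le.
Qed.

Lemma stateset_step : in_stateset N umax (lstm_step N u chi).
Proof.
move=> j; split; first exact: norm_lstm_step_cell_le.
by rewrite -ltr_norml norm_lstm_step_hidden_lt1.
Qed.

End AdmissibleState.

Lemma stateset_traj (u : nat -> 'cV[R]_nu) chi k :
  (forall h, in_inputset umax (u h)) -> in_stateset N umax chi ->
  in_stateset N umax (lstm_traj N u chi k).
Proof. by move=> uU chiX; elim: k => //= k IH; exact: stateset_step. Qed.

(* [alpha_lstm] is the instance at the matrices [U]; the one at the matrices [W] is the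
   gain from the input. *)
Definition cell_gain m (F I C : 'M[R]_(nx, m)) : R :=
  4^-1 * opnorm2 F * xbound N umax + sgi N umax * opnorm2 C
  + 4^-1 * opnorm2 I * scc N umax.

Lemma cell_gain_ge0 m (F I C : 'M[R]_(nx, m)) : 0 <= cell_gain F I C.
Proof.
apply: addr_ge0 (addr_ge0 _ _) _.
- exact: mulr_ge0 (mulr_ge0 quarter_ge0 (opnorm2_ge0 F)) xbound_ge0.
- exact: mulr_ge0 sgi_ge0 (opnorm2_ge0 C).
- exact: mulr_ge0 (mulr_ge0 quarter_ge0 (opnorm2_ge0 I)) scc_ge0.
Qed.

Definition input_gain : 'cV[R]_2 :=
  let cell := cell_gain (Wf N) (Wi N) (Wc N) in
  \col_i if i == 0 then cell
         else sgo N umax * cell + 4^-1 * scx N umax * opnorm2 (Wo N).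

Lemma input_gain_ge0 : lemx 0 input_gain.
Proof.
move=> i j; rewrite !mxE; case: ifP => _; first exact: cell_gain_ge0.
apply: addr_ge0; first exact: mulr_ge0 sgo_ge0 (cell_gain_ge0 _ _ _).
exact: mulr_ge0 (mulr_ge0 quarter_ge0 scx_ge0) (opnorm2_ge0 _).
Qed.

Lemma A_delta_ge0 : lemx 0 (A_delta N umax).
Proof.
have alpha_ge0 : 0 <= alpha_lstm N umax by exact: cell_gain_ge0.
apply: forall_ord2; apply: forall_ord2; rewrite !mxE /=.
- exact: sgf_ge0.
- exact: alpha_ge0.
- exact: mulr_ge0 sgo_ge0 sgf_ge0.
- apply: addr_ge0 (mulr_ge0 alpha_ge0 sgo_ge0) _.
  exact: mulr_ge0 (mulr_ge0 quarter_ge0 scx_ge0) (opnorm2_ge0 _).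
Qed.

Section OneStep.
Variables (u1 u2 : 'cV[R]_nu) (chi1 chi2 : 'cV[R]_nx * 'cV[R]_nx).
Hypotheses (uU1 : in_inputset umax u1) (uU2 : in_inputset umax u2).
Hypotheses (chiX1 : in_stateset N umax chi1) (chiX2 : in_stateset N umax chi2).

Let next1 := lstm_step N u1 chi1.
Let next2 := lstm_step N u2 chi2.

Lemma norm2_cell_stepB : norm2 (next1.1 - next2.1)
  <= sgf N umax * norm2 (chi1.1 - chi2.1)
     + alpha_lstm N umax * norm2 (chi1.2 - chi2.2)
     + cell_gain (Wf N) (Wi N) (Wc N) * norm2 (u1 - u2).
Proof.
have gateB f (k r : R) W U b : 0 <= k -> 0 <= r -> k.-lipschitz f ->
    r * norm2 (gate f W U b u1 chi1.2 - gate f W U b u2 chi2.2) <=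
    r * (k * (opnorm2 W * norm2 (u1 - u2) + opnorm2 U * norm2 (chi1.2 - chi2.2))).
  by move=> k0 r0 f_lip; rewrite ler_wpM2l // norm2_gateB.
rewrite /next1 /next2 !lstm_step_cellE opprD addrACA.
apply: le_trans (ler_norm2D _ _) _.
apply: (@le_trans _ _
  ((sgf N umax * norm2 (chi1.1 - chi2.1)
    + xbound N umax * norm2 (forget_gate u1 chi1 - forget_gate u2 chi2))
   + (sgi N umax * norm2 (candidate u1 chi1 - candidate u2 chi2)
      + scc N umax * norm2 (input_gate u1 chi1 - input_gate u2 chi2)))).
  apply: lerD.
  - apply: (norm2_hadamardB _ _ sgf_ge0 xbound_ge0) => i; last by have [] := chiX2 i.
    exact: norm_forget_gate_le.
  - apply: (norm2_hadamardB _ _ sgi_ge0 scc_ge0) => i; first exact: norm_input_gate_le.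
    exact: norm_candidate_le.
apply: le_trans (lerD
  (lerD (lexx _) (gateB _ _ _ _ _ _ quarter_ge0 xbound_ge0 (@lipschitz_sigmoid R)))
  (lerD (gateB _ _ _ _ _ _ ler01 sgi_ge0 (@lipschitz_tanhR R))
        (gateB _ _ _ _ _ _ quarter_ge0 scc_ge0 (@lipschitz_sigmoid R)))) _.
move: (norm2 (u1 - u2)) (norm2 (chi1.1 - chi2.1)) (norm2 (chi1.2 - chi2.2)) => du dx dxi.
rewrite /alpha_lstm /cell_gain; lra.
Qed.

Lemma norm2_hidden_stepB : norm2 (next1.2 - next2.2)
  <= sgo N umax * norm2 (next1.1 - next2.1)
     + scx N umax * (4^-1 * (opnorm2 (Wo N) * norm2 (u1 - u2)
                             + opnorm2 (Uo N) * norm2 (chi1.2 - chi2.2))).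
Proof.
rewrite /next1 /next2 !lstm_step_hiddenE.
have out_le i : `|output_gate u1 chi1 i 0| <= sgo N umax by exact: norm_output_gate_le.
have tanh_le i : `|cmap (@tanhR R) next2.1 i 0| <= scx N umax.
  by rewrite cmapE; exact/norm_tanhR_le/norm_lstm_step_cell_le.
apply: le_trans (norm2_hadamardB _ _ sgo_ge0 scx_ge0 out_le tanh_le) _.
apply: lerD.
- by rewrite ler_wpM2l ?sgo_ge0 // -[leRHS]mul1r; exact/norm2_cmapB/lipschitz_tanhR.
- rewrite ler_wpM2l ?scx_ge0 //.
  exact: norm2_gateB quarter_ge0 (@lipschitz_sigmoid R).
Qed.

Lemma state_gap_step : lemx (state_gap next1 next2)
  (A_delta N umax *m state_gap chi1 chi2 + norm2 (u1 - u2) *: input_gain).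
Proof.
have cellB := norm2_cell_stepB; have hiddenB := norm2_hidden_stepB.
have sgo_cellB := ler_wpM2l sgo_ge0 cellB.
apply: forall_ord2 => j; rewrite ord1 !mxE sum_ord2 !mxE /=.
- by lra.
- by lra.
Qed.

End OneStep.

Section Trajectories.
Variables (u1 u2 : nat -> 'cV[R]_nu) (chi01 chi02 : 'cV[R]_nx * 'cV[R]_nx).
Hypotheses (uU1 : forall h, in_inputset umax (u1 h)).
Hypotheses (uU2 : forall h, in_inputset umax (u2 h)).
Hypotheses (chiX1 : in_stateset N umax chi01) (chiX2 : in_stateset N umax chi02).

Let traj_gap k := state_gap (lstm_traj N u1 chi01 k) (lstm_traj N u2 chi02 k).

Lemma state_gap_traj_step k : lemx (traj_gap k.+1)
  (A_delta N umax *m traj_gap k + input_dist u1 u2 *: input_gain).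
Proof.
move=> i j; have X1 := stateset_traj k uU1 chiX1; have X2 := stateset_traj k uU2 chiX2.
apply: le_trans (state_gap_step (uU1 k) (uU2 k) X1 X2 i j) _.
rewrite [leLHS]mxE [leRHS]mxE lerD2l [leLHS]mxE [leRHS]mxE ler_wpM2r //.
  by have := input_gain_ge0 i j; rewrite mxE.
exact: le_input_dist uU1 uU2.
Qed.

End Trajectories.

Lemma state_dist_traj_geometric_bound :
  specrad (A_delta N umax) < 1 ->
  exists C g l : R, [/\ 0 < C, 0 <= g, 0 < l < 1 &
    forall chi01 chi02 (u1 u2 : nat -> 'cV[R]_nu) k,
      in_stateset N umax chi01 -> in_stateset N umax chi02 ->
      (forall h, in_inputset umax (u1 h)) -> (forall h, in_inputset umax (u2 h)) ->
      state_dist (lstm_traj N u1 chi01 k) (lstm_traj N u2 chi02 k)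
      <= C * l ^+ k * state_dist chi01 chi02 + g * input_dist u1 u2].
Proof.
move=> /(nonneg_mx2_decreasing_weights A_delta_ge0)[p p0 pA].
have [l l01 plA] := decreasing_weights_factor p0 pA; have /andP[l0 l1] := l01.
have [C C0 gap_bound] := comparison_geometric_bound p0 l01 plA.
have total_gain_ge0 : 0 <= \sum_i input_gain i 0.
  by apply: sumr_ge0 => i _; have := input_gain_ge0 i 0; rewrite mxE.
exists (C * 2), (C * (\sum_i input_gain i 0) / (1 - l)), l; split => //.
- by rewrite mulr_gt0.
- by rewrite divr_ge0 ?mulr_ge0 ?(ltW C0) // subr_ge0 ltW.
move=> chi01 chi02 u1 u2 k chiX1 chiX2 uU1 uU2.
have input_dist_ge0 := le_trans (norm2_ge0 _) (le_input_dist 0 uU1 uU2).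
apply: le_trans (state_dist_le_sum_gap _ _) _.
apply: le_trans (gap_bound _ (input_dist u1 u2 *: input_gain) _ _
  (state_gap_traj_step uU1 uU2 chiX1 chiX2) k) _ => [j|i j|].
- exact: state_gap_ge0.
- by rewrite [leRHS]mxE mxE mulr_ge0 //; have := input_gain_ge0 i j; rewrite mxE.
have -> : \sum_i (input_dist u1 u2 *: input_gain) i 0 =
    input_dist u1 u2 * (\sum_i input_gain i 0).
  by rewrite mulr_sumr; apply: eq_bigr => i _; rewrite mxE.
have decay_ge0 : 0 <= C * l ^+ k by rewrite mulr_ge0 ?exprn_ge0 ?(ltW l0) ?(ltW C0).
have := ler_wpM2l decay_ge0 (sum_gap_le_state_dist chi01 chi02).
by rewrite /=; lra.
Qed.

End Network.

Theorem theorem2 (R : realType) (nx nu : nat) (N : lstm R nx nu) (umax : R) :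
  specrad (A_delta N umax) < 1 ->
  exists (beta : R -> nat -> R) (gamma : R -> R),
    [/\ classKL beta, classKinf gamma &
      forall (k : nat) (chi01 chi02 : 'cV[R]_nx * 'cV[R]_nx)
             (u1 u2 : nat -> 'cV[R]_nu),
        in_stateset N umax chi01 -> in_stateset N umax chi02 ->
        (forall h, in_inputset umax (u1 h)) ->
        (forall h, in_inputset umax (u2 h)) ->
        state_dist (lstm_traj N u1 chi01 k) (lstm_traj N u2 chi02 k)
        <= beta (state_dist chi01 chi02) k + gamma (input_dist u1 u2)].
Proof.
move=> /state_dist_traj_geometric_bound[C [g [l [C0 g0 l01 dist_le]]]].
exists (fun s k => C * l ^+ k * s), (fun s => (g + 1) * s); split.
- exact: classKL_geometric.
- by apply: classKinf_linear; rewrite ltr_wpDl.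
move=> k chi01 chi02 u1 u2 chiX1 chiX2 uU1 uU2.
apply: le_trans (dist_le _ _ _ _ k chiX1 chiX2 uU1 uU2) _.
rewrite lerD2l ler_wpM2r ?lerDl //.
exact: le_trans (norm2_ge0 _) (le_input_dist 0 uU1 uU2).
Qed.
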